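(* Let $f_{A\{0\}},f_{B\{0\}},f_{C\{0\}},p_A,p_{\hat C}$ be trigonometric polynomials, and let the matrices $A\{\ell\},B\{\ell\},C\{\ell\}$ with symbols $f_{A\{\ell\}},f_{B\{\ell\}},f_{C\{\ell\}}$ be defined, for $n_0=2^\beta$, by the multigrid recursion described in the context. Let $q_A$ and $q_{\hat C}$ be the degrees of $p_A$ and $p_{\hat C}$, let $q=\max\{q_A,q_{\hat C}\}$, and let $z_{B\{\ell\}}$, $z_{C\{\ell\}}$ be the degrees of the trigonometric polynomials $f_{B\{\ell\}}$, $f_{C\{\ell\}}$. Then, for $\ell$ large enough (that is, there is $\ell_0$ not depending on $\beta$ such that the following holds at every level $\ell\ge\ell_0$ of the recursion), 1. $z_{B\{\ell\}}\le\max(2z_{B\{0\}},\,4q)$; 2. $z_{C\{\ell\}}\le\max(4z_{B\{0\}},\,6q,\,2z_{C\{0\}})$.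
   Context: A trigonometric polynomial has degree $z$ if it has the form $\sum_{|j|\le z}a_je^{\mathrm{i}j\theta}$ with $a_z\neq0$ or $a_{-z}\ne0$ (constants, including zero, have degree $0$). $\hat a_0(f)=\frac1{2\pi}\int_{-\pi}^{\pi}f(\theta)\,d\theta$. $\mathcal{C}_n(f)=\mathbb{F}_n\,\mathrm{diag}_{j=1,\dots,n}\big(f(\theta_{j,n})\big)\mathbb{F}_n^H$ is the circulant matrix with symbol $f$, where $\theta_{j,n}=\frac{2\pi(j-1)}{n}$ and $(\mathbb{F}_n)_{i,j}=\frac1{\sqrt n}e^{\mathrm{i}(i-1)\theta_{j,n}}$. $D_X$ is the diagonal matrix with the same main diagonal as $X$. For even $n$, $K_n\in\mathbb{R}^{\frac n2\times n}$ has $(K_n)_{i,2i-1}=1$, $i=1,\dots,n/2$, and zeros elsewhere. Recursion. Let $n_0=2^\beta$, $n_{\ell+1}=n_\ell/2$, $A\{0\}=\mathcal{C}_{n_0}(f_{A\{0\}})$, $B\{0\}=\mathcal{C}_{n_0}(f_{B\{0\}})$, $C\{0\}=\mathcal{C}_{n_0}(f_{C\{0\}})$. At each level $\ell$, with $\alpha_\ell=\|D_{A\{\ell\}}^{-1}A\{\ell\}\|_2^{-1}$, $P_{A\{\ell\}}=\mathcal{C}_{n_\ell}(p_A)K_{n_\ell}^T$, $P_{\hat C\{\ell\}}=\mathcal{C}_{n_\ell}(p_{\hat C})K_{n_\ell}^T$, $$\hat C\{\ell\}=C\{\ell\}+B\{\ell\}\left(2\alpha_\ell D_{A\{\ell\}}^{-1}-\alpha_\ell^2D_{A\{\ell\}}^{-1}A\{\ell\}D_{A\{\ell\}}^{-1}\right)B\{\ell\}^H,$$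 $$A\{\ell+1\}=P_{A\{\ell\}}^HA\{\ell\}P_{A\{\ell\}},\quad B\{\ell+1\}=P_{\hat C\{\ell\}}^HB\{\ell\}\left(I_{n_\ell}-\alpha_\ell D_{A\{\ell\}}^{-1}A\{\ell\}\right)P_{A\{\ell\}},\quad C\{\ell+1\}=P_{\hat C\{\ell\}}^H\hat C\{\ell\}P_{\hat C\{\ell\}}.$$ It is assumed that $A\{\ell\}\neq0$, that $D_{A\{\ell\}}$ is invertible and that $\hat a_0(f_{A\{\ell\}})\ne0$ at all levels considered, so that everything is well defined. All matrices are circulant, and their symbols are given recursively, with $\psi(g)(\theta)=\frac12\left[g(\tfrac\theta2)+g(\tfrac\theta2+\pi)\right]$, by $$f_{A\{\ell+1\}}=\psi(|p_A|^2f_{A\{\ell\}}),\qquad f_{B\{\ell+1\}}=\psi\Big(\overline{p_{\hat C}}\,p_A\,f_{B\{\ell\}}\big(1-\tfrac{\alpha_\ell}{\hat a_0(f_{A\{\ell\}})}f_{A\{\ell\}}\big)\Big),$$ $$f_{\hat C\{\ell\}}=f_{C\{\ell\}}+\frac{\alpha_\ell|f_{B\{\ell\}}|^2}{\hat a_0(f_{A\{\ell\}})}\Big(2-\frac{\alpha_\ell}{\hat a_0(f_{A\{\ell\}})}f_{A\{\ell\}}\Big),\qquad f_{C\{\ell+1\}}=\psi(|p_{\hat C}|^2f_{\hat C\{\ell\}}).$$ The degrees $z_{B\{\ell\}},z_{C\{\ell\}}$ refer to these symbols. *)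

(* Defs.v *)
From HB Require Import structures.
From mathcomp Require Import all_boot all_order all_algebra.
From mathcomp Require Import all_classical all_reals all_analysis.
From mathcomp Require Import complex.

Set Implicit Arguments.
Unset Strict Implicit.
Unset Printing Implicit Defensive.

Import Order.TTheory GRing.Theory Num.Theory.

Local Open Scope classical_set_scope.
Local Open Scope complex_scope.
Local Open Scope ring_scope.

Section TrigonometricPolynomials.
Variable R : realType.
Implicit Types (f g : R -> R[i]) (t : R) (a : int -> R[i]).

Definition expi t : R[i] := cos t +i* sin t.

(* The frequencies - z, ..., z are enumerated as k - z for 0 <= k <= 2 z. *)
Definition trig_sum (z : nat) a t : R[i] :=
  \sum_(k < (z.*2).+1)
    a (k%:Z - z%:Z) * expi ((k%:Z - z%:Z)%:~R * t).

Definition is_trig_poly f : Prop :=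
  exists z a, forall t, f t = trig_sum z a t.

(* For z = 0 no coefficient has to be nonzero: all constants, including 0,
   have degree 0. *)
Definition trig_degree f (z : nat) : Prop :=
  exists a, (forall t, f t = trig_sum z a t) /\
    [\/ z = 0%N, a z%:Z != 0 | a (- z%:Z) != 0].

(* The integral of a complex function is taken componentwise. *)
Definition hat_a0 f : R[i] :=
  ((pi *+ 2)^-1)%:C *
  ((\int[lebesgue_measure]_(t in `[- pi, pi]) complex.Re (f t))
    +i* (\int[lebesgue_measure]_(t in `[- pi, pi]) complex.Im (f t))).

Definition psi g : R -> R[i] :=
  fun t => 2^-1 * (g (t / 2) + g (t / 2 + pi)).

End TrigonometricPolynomials.

Section Matrices.
Variable R : realType.

Definition hermx m n (M : 'M[R[i]]_(m, n)) : 'M[R[i]]_(n, m) :=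
  map_mx Num.conj M^T.

Definition norm2 n (v : 'cV[R[i]]_n) : R :=
  Num.sqrt (\sum_i (complex.Re `|v i ord0|) ^+ 2).

Definition spectral_norm m n (M : 'M[R[i]]_(m, n)) : R :=
  sup [set norm2 (M *m v) | v in [set v : 'cV[R[i]]_n | norm2 v = 1]].

Definition diag_part n (M : 'M[R[i]]_n) : 'M[R[i]]_n :=
  diag_mx (\row_i M i i).

(* Indices are 0-based. *)
Definition grid (n : nat) (j : nat) : R := pi *+ 2 * j%:R / n%:R.

Definition fourier_mx (n : nat) : 'M[R[i]]_n :=
  \matrix_(i < n, j < n) ((Num.sqrt n%:R)^-1%:C * expi (i%:R * grid n j)).

Definition circulant (n : nat) (f : R -> R[i]) : 'M[R[i]]_n :=
  fourier_mx n *m diag_mx (\row_(j < n) f (grid n j)) *m hermx (fourier_mx n).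

(* K_n, meaningful for even n; 0-based, row i selects column 2 i. *)
Definition cutting_mx (n : nat) : 'M[R[i]]_(n./2, n) :=
  \matrix_(i < n./2, j < n) (j == i.*2 :> nat)%:R.

Definition prolongation (n : nat) (p : R -> R[i]) : 'M[R[i]]_(n, n./2) :=
  circulant n p *m (cutting_mx n)^T.

End Matrices.

Section Multigrid.
Variable R : realType.

Record mg_level (n : nat) := MgLevel {
  mat_A : 'M[R[i]]_n;
  mat_B : 'M[R[i]]_n;
  mat_C : 'M[R[i]]_n;
  sym_A : R -> R[i];
  sym_B : R -> R[i];
  sym_C : R -> R[i]
}.

Section Step.
Variables (pA pC : R -> R[i]) (n : nat) (L : mg_level n).

Let A := mat_A L.
Let B := mat_B L.
Let C := mat_C L.
Let fA := sym_A L.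
Let fB := sym_B L.
Let fC := sym_C L.
Let DAinv := invmx (diag_part A).
Let PA := prolongation n pA.
Let PC := prolongation n pC.

Definition mg_alpha : R := (spectral_norm (DAinv *m A))^-1.

Let al : R[i] := mg_alpha%:C.

Definition mat_Chat : 'M[R[i]]_n :=
  C + B *m ((2 * al) *: DAinv - (al ^+ 2) *: (DAinv *m A *m DAinv)) *m hermx B.

Definition sym_Chat : R -> R[i] := fun t =>
  fC t + al * `|fB t| ^+ 2 / hat_a0 fA * (2 - al / hat_a0 fA * fA t).

Definition mg_step : mg_level n./2 := {|
  mat_A := hermx PA *m A *m PA;
  mat_B := hermx PC *m B *m (1%:M - al *: (DAinv *m A)) *m PA;
  mat_C := hermx PC *m mat_Chat *m PC;
  sym_A := psi (fun t => `|pA t| ^+ 2 * fA t);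
  sym_B := psi (fun t =>
    Num.conj (pC t) * pA t * fB t * (1 - al / hat_a0 fA * fA t));
  sym_C := psi (fun t => `|pC t| ^+ 2 * sym_Chat t)
|}.

Definition mg_well_defined : Prop :=
  [/\ A != 0, diag_part A \in unitmx & hat_a0 fA != 0].

End Step.

Variables (fA0 fB0 fC0 pA pC : R -> R[i]) (beta : nat).

Definition mg_init (n : nat) : mg_level n := {|
  mat_A := circulant n fA0;
  mat_B := circulant n fB0;
  mat_C := circulant n fC0;
  sym_A := fA0;
  sym_B := fB0;
  sym_C := fC0
|}.

Fixpoint mg_size (l : nat) : nat :=
  if l is l'.+1 then (mg_size l')./2 else (2 ^ beta)%N.

Fixpoint multigrid (l : nat) : mg_level (mg_size l) :=
  match l with
  | 0 => mg_init (2 ^ beta)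
  | l'.+1 => mg_step pA pC (multigrid l')
  end.

End Multigrid.

(* Main.v *)
(** The symbols at every level are trigonometric polynomials whose frequencies
    can be bounded recursively: [psi] halves the frequency range, while
    multiplication adds frequency bounds, whatever the values of the scalars
    [alpha_l] and [hat_a0]. So bounds [a], [b], [c] for [A{l}], [B{l}], [C{l}]
    yield the bounds [(a + 2q)/2], [(2q + b + a)/2] and
    [(2q + max(c, 2b + a))/2] at level [l + 1]. Such halving recursions bring
    [a] below [2q], then [b] below [4q], then [c] below [6q], after a number of
    steps depending only on the initial degrees. *)
Require Import Defs.
From mathcomp Require Import all_boot all_order all_algebra.
From mathcomp Require Import all_classical all_reals all_analysis.
From mathcomp Require Import complex.
From mathcomp Require Import zify ring.

Set Implicit Arguments.
Unset Strict Implicit.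
Unset Printing Implicit Defensive.

Import Order.TTheory GRing.Theory Num.Theory.

Local Open Scope complex_scope.
Local Open Scope ring_scope.

Section TrigLe.
Variable R : realType.
Implicit Types (f g : R -> R[i]) (s t : R) (z : nat) (n : int) (c : R[i]).

Lemma expi0 : expi (0 : R) = 1.
Proof. by rewrite /expi cos0 sin0. Qed.

Lemma expiD s t : expi (s + t) = expi s * expi t.
Proof. by rewrite /expi cosD sinD; simpc; rewrite [cos s * sin t + _]addrC. Qed.

Lemma conj_expi t : Num.conj (expi t) = expi (- t).
Proof. by rewrite /expi cosN sinN. Qed.

Lemma expi_npi (k : nat) : expi (k%:R * pi : R) = (-1) ^+ k.
Proof.
elim: k => [|k IHk]; first by rewrite mul0r expi0 expr0.
rewrite -natr1 mulrDl mul1r expiD IHk exprSr; congr (_ * _).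
by rewrite /expi cospi sinpi; simpc.
Qed.

Lemma expi_zpi n : expi (n%:~R * pi : R) = (-1) ^+ `|n|%N.
Proof.
case: n => k; first by rewrite -pmulrn expi_npi.
rewrite NegzE mulrNz mulNr -conj_expi -pmulrn expi_npi rmorphXn rmorphN1.
by rewrite abszN.
Qed.

(** An upper bound on the degree, with no condition on the extreme coefficients. Unlike the exact
    degree, it survives cancellation in sums and [psi]. *)
Definition trig_le z f : Prop := exists a, forall t, f t = trig_sum z a t.

Lemma trig_degree_le f z : trig_degree f z -> trig_le z f.
Proof. by case=> a [fE _]; exists a. Qed.

Lemma trig_sumS z (a : int -> R[i]) t :
  trig_sum z.+1 a t =
  a (- z.+1%:Z) * expi ((- z.+1%:Z)%:~R * t) + trig_sum z a t
    + a z.+1%:Z * expi (z.+1%:Z%:~R * t).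
Proof.
rewrite /trig_sum doubleS big_ord_recl big_ord_recr /= addrA sub0r.
congr (_ + _ + _); last first.
  by have -> : (bump 0 (z.*2).+1)%:Z - z.+1%:Z = z.+1%:Z :> int by rewrite /bump; lia.
apply: eq_bigr => k _ /=.
by have -> : (bump 0 k)%:Z - z.+1%:Z = k%:Z - z%:Z :> int by rewrite /bump; lia.
Qed.

(** As long as both extreme coefficients vanish, they are stripped and [z] drops by one; the descent
    stops at a nonzero one or at a constant. *)
Lemma trig_le_degree f z :
  trig_le z f -> exists z', trig_degree f z' /\ (z' <= z)%N.
Proof.
elim: z => [|z IHz] [a fE]; first by exists 0; split=> //; exists a; split=> //; constructor 1.
have [az0|az] := eqVneq (a z.+1%:Z) 0; last first.
  by exists z.+1; split=> //; exists a; split=> //; constructor 2.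
have [aNz0|aNz] := eqVneq (a (- z.+1%:Z)) 0; last first.
  by exists z.+1; split=> //; exists a; split=> //; constructor 3.
have [|z' [fz' lez']] := IHz; last by exists z'; split=> //; apply: leqW.
by exists a => t; rewrite fE trig_sumS az0 aNz0 !mul0r add0r addr0.
Qed.

Lemma trig_leD f g z :
  trig_le z f -> trig_le z g -> trig_le z (fun t => f t + g t).
Proof.
move=> [a fE] [b gE]; exists (fun n => a n + b n) => t.
by rewrite fE gE -big_split; apply: eq_bigr => k _; rewrite mulrDl.
Qed.

Lemma trig_le_sum (I : Type) (r : seq I) (F : I -> R -> R[i]) z :
  (forall i, trig_le z (F i)) -> trig_le z (fun t => \sum_(i <- r) F i t).
Proof.
move=> Fz; elim: r => [|i r [a aE]].
  exists (fun=> 0) => t; rewrite big_nil /trig_sum big1 // => k _.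
  by rewrite mul0r.
have [b bE] := trig_leD (Fz i) (ex_intro _ a aE).
by exists b => t; rewrite big_cons bE.
Qed.

Lemma trig_le_monomial c n z :
  (`|n| <= z)%N -> trig_le z (fun t => c * expi (n%:~R * t)).
Proof.
move=> nz; exists (fun m => if m == n then c else 0) => t.
(* Frequency [n] sits at index [n + z] of the enumeration [k - z]. *)
have kz : (absz (n + z%:Z)%R < (z.*2).+1)%N by lia.
rewrite /trig_sum (bigD1 (Ordinal kz)) //= big1 ?addr0 => [|k /eqP kn].
  by have -> : (absz (n + z%:Z))%:Z - z%:Z = n by [lia]; rewrite eqxx.
case: eqP => [knz|]; last by rewrite mul0r.
by case: kn; apply: val_inj => /=; lia.
Qed.

(** Reduces a linear operation on a trigonometric polynomial to monomials: [P c n] stands for the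
    image of the monomial with coefficient [c] and frequency [n]. *)
Lemma trig_le_monomials f z z' (a : int -> R[i]) (P : R[i] -> int -> R -> R[i]) :
  (forall c n, (`|n| <= z)%N -> trig_le z' (P c n)) ->
  (forall t, f t = \sum_(k < (z.*2).+1) P (a (k%:Z - z%:Z)) (k%:Z - z%:Z) t) ->
  trig_le z' f.
Proof.
move=> Pz' fE; suff [b bE] : trig_le z' (fun t =>
    \sum_(k < (z.*2).+1) P (a (k%:Z - z%:Z)) (k%:Z - z%:Z) t).
  by exists b => t; rewrite fE bE.
by apply: trig_le_sum => k; apply: Pz'; have := ltn_ord k; lia.
Qed.

Lemma trig_leW f z z' : (z <= z')%N -> trig_le z f -> trig_le z' f.
Proof.
move=> lezz' [a fE].
apply: (@trig_le_monomials _ z z' a (fun c n t => c * expi (n%:~R * t))) => //.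
by move=> c n nz; apply: trig_le_monomial; apply: leq_trans lezz'.
Qed.

Lemma trig_le_cst c z : trig_le z (fun=> c).
Proof.
have [a aE] : trig_le z (fun t => c * expi (0%:~R * t)).
  by apply: trig_le_monomial.
by exists a => t; rewrite -aE mul0r expi0 mulr1.
Qed.

Lemma trig_leM f g z z' :
  trig_le z f -> trig_le z' g -> trig_le (z + z') (fun t => f t * g t).
Proof.
move=> [a fE] [b gE].
(* First [f] is expanded with [g] kept whole, then [g] against each monomial of [f]; frequencies of
   monomials add. *)
apply: (@trig_le_monomials _ z _ a (fun c n t => c * expi (n%:~R * t) * g t)).
  move=> c n nz.
  apply: (@trig_le_monomials _ z' _ b
    (fun d m t => c * d * expi ((n + m)%:~R * t))).
    by move=> d m mz'; apply: trig_le_monomial; lia.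
  move=> t; rewrite gE mulr_sumr; apply: eq_bigr => k _.
  by rewrite mulrACA -expiD -mulrDl -intrD.
by move=> t; rewrite fE mulr_suml.
Qed.

Lemma trig_le_conj f z : trig_le z f -> trig_le z (fun t => Num.conj (f t)).
Proof.
move=> [a fE]; apply: (@trig_le_monomials _ z _ a
  (fun c n t => Num.conj c * expi ((- n)%:~R * t))).
  by move=> c n nz; apply: trig_le_monomial; rewrite abszN.
move=> t; rewrite fE rmorph_sum; apply: eq_bigr => k _.
by rewrite rmorphM /= conj_expi mulrNz mulNr.
Qed.

Lemma trig_le_sqr_norm f z : trig_le z f -> trig_le z.*2 (fun t => `|f t| ^+ 2).
Proof.
move=> fz; have [a aE] := trig_leM fz (trig_le_conj fz).
by rewrite -addnn; exists a => t; rewrite normCK aE.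
Qed.

(* Odd frequencies cancel under [psi], even ones are halved. *)
Lemma trig_le_psi g z : trig_le z g -> trig_le z./2 (psi g).
Proof.
move=> [a gE]; apply: (@trig_le_monomials _ z _ a
  (fun c n => psi (fun t => c * expi (n%:~R * t)))); last first.
  move=> t; rewrite /psi !gE -big_split mulr_sumr.
  by apply: eq_bigr.
move=> c n nz.
(* [n / 2] truncated towards zero. For odd [n] the coefficient is set to [0], so only [|m| <= z / 2]
   matters there. *)
pose m := (if 0 <= n then (`|n|./2)%:Z else - (`|n|./2)%:Z) : int.
have [b bE] : trig_le z./2
    (fun t => (if odd `|n| then 0 else c) * expi (m%:~R * t)).
  by apply: trig_le_monomial; rewrite /m; case: ifP; lia.
exists b => t; rewrite -bE /psi [_ * (t / 2 + pi)]mulrDr expiD expi_zpi -signr_odd.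
case: ifPn => [_|even_n]; first by rewrite expr1 mulrN1 mulrN subrr mulr0 mul0r.
have -> : n = m * 2 by rewrite /m; case: ifP; lia.
have -> : (m * 2)%:~R * (t / 2) = m%:~R * t.
  by rewrite rmorphM /=; field.
by rewrite expr0 mulr1; field.
Qed.

End TrigLe.

Lemma mg_step_trig_le (R : realType) (pA pC : R -> R[i]) (n : nat)
    (L : mg_level R n) (q a b c : nat) :
  trig_le q pA -> trig_le q pC ->
  trig_le a (sym_A L) -> trig_le b (sym_B L) -> trig_le c (sym_C L) ->
  [/\ trig_le (a + q.*2)./2 (sym_A (mg_step pA pC L)),
      trig_le (q.*2 + b + a)./2 (sym_B (mg_step pA pC L))
    & trig_le (q.*2 + maxn c (b.*2 + a))./2 (sym_C (mg_step pA pC L))].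
Proof.
move=> hpA hpC hA hB hC.
(* Covers both factors affine in [sym_A L], for arbitrary values of the scalars. *)
have hAff (x y : R[i]) : trig_le a (fun t => x - y * sym_A L t).
  have := trig_leD (trig_le_cst x a) (trig_leM (trig_le_cst (- y) 0) hA).
  by case=> d dE; exists d => t; rewrite -dE mulNr.
split; apply: trig_le_psi.
- rewrite addnC; exact: (trig_leM (trig_le_sqr_norm hpA) hA).
- rewrite -addnn.
  exact: (trig_leM (trig_leM (trig_leM (trig_le_conj hpC) hpA) hB) (hAff _ _)).
- apply: (trig_leM (trig_le_sqr_norm hpC)).
  apply: (trig_leD (trig_leW (leq_maxl _ _) hC)).
  (* The added [0] is the degree of the constant factor [(hat_a0 (sym_A L))^-1]. *)
  apply: (trig_leW (leq_maxr _ _)); rewrite -[b.*2]addn0.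
  apply: (trig_leM (trig_leM _ (trig_le_cst _ 0)) (hAff _ _)).
  exact: (trig_leM (trig_le_cst _ 0) (trig_le_sqr_norm hB)).
Qed.

(** If [u l > M >= 2c], then [u l / 2 + c < u l], so the excess over [M] loses at least one per
    step; once at most [M], [u] stays there. Hence [u l1] steps after [l1] suffice. *)
Lemma halving_eventually_le (u : nat -> nat) (c M l1 : nat) :
  (c.*2 <= M)%N ->
  (forall l, (l1 <= l)%N -> (u l.+1 <= maxn ((u l)./2 + c) M)%N) ->
  exists l0, forall l, (l0 <= l)%N -> (u l <= M)%N.
Proof.
move=> cM uS.
have u_le k : (u (l1 + k) <= M + (u l1 - k))%N.
  elim: k => [|k IHk]; first by rewrite addn0; lia.
  by have := uS (l1 + k)%N (leq_addr _ _); rewrite addnS; lia.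
exists (l1 + u l1)%N => l l0l.
by have := u_le (l - l1)%N; rewrite subnKC; lia.
Qed.

Section DegreeBounds.
Variables q zA0 zB0 zC0 : nat.

Fixpoint bound_A l :=
  if l is l'.+1 then (bound_A l' + q.*2)./2 else zA0.

Fixpoint bound_B l :=
  if l is l'.+1 then (q.*2 + bound_B l' + bound_A l')./2 else zB0.

Fixpoint bound_C l :=
  if l is l'.+1 then
    (q.*2 + maxn (bound_C l') ((bound_B l').*2 + bound_A l'))./2
  else zC0.

(** [2q] is the fixed point of [a -> (a + 2q) / 2]. *)
Lemma bound_A_eventually :
  exists l0, forall l, (l0 <= l)%N -> (bound_A l <= 2 * q)%N.
Proof. by apply: (@halving_eventually_le _ q _ 0) => [|l _ /=]; lia. Qed.

Lemma bound_B_eventually :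
  exists l0, forall l, (l0 <= l)%N -> (bound_B l <= 4 * q)%N.
Proof.
have [lA hA] := bound_A_eventually.
(* Once [a <= 2q], the recursion gives at most [b / 2 + 2q], with fixed point [4q]. *)
apply: (@halving_eventually_le _ (2 * q) _ lA) => [|l lAl /=]; first by lia.
by have := hA l lAl; lia.
Qed.

Lemma bound_C_eventually :
  exists l0, forall l, (l0 <= l)%N -> (bound_C l <= 6 * q)%N.
Proof.
have [lA hA] := bound_A_eventually; have [lB hB] := bound_B_eventually.
(* Now [2b + a <= 10q], so the second branch of the maximum gives at most [(2q + 10q) / 2 = 6q], and
   the first gives [c / 2 + q]. *)
apply: (@halving_eventually_le _ q _ (maxn lA lB)) => [|l]; first by lia.
rewrite geq_max => /andP[lAl lBl] /=.
by have := hA l lAl; have := hB l lBl; lia.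
Qed.

Variables (R : realType) (fA0 fB0 fC0 pA pC : R -> R[i]).
Hypotheses (hA0 : trig_le zA0 fA0) (hB0 : trig_le zB0 fB0)
  (hC0 : trig_le zC0 fC0) (hpA : trig_le q pA) (hpC : trig_le q pC).

Lemma multigrid_trig_le beta l :
  let L := multigrid fA0 fB0 fC0 pA pC beta l in
  [/\ trig_le (bound_A l) (sym_A L), trig_le (bound_B l) (sym_B L)
    & trig_le (bound_C l) (sym_C L)].
Proof.
elim: l => [//|l [hA hB hC]]; exact: (mg_step_trig_le hpA hpC hA hB hC).
Qed.

End DegreeBounds.

Theorem lemma7 (R : realType) (fA0 fB0 fC0 pA pC : R -> R[i])
    (zB0 zC0 qA qC : nat)
    (hA0 : is_trig_poly fA0)
    (hB0 : trig_degree fB0 zB0)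
    (hC0 : trig_degree fC0 zC0)
    (hpA : trig_degree pA qA)
    (hpC : trig_degree pC qC) :
  let q := maxn qA qC in
  exists l0 : nat, forall beta l : nat,
    (l0 <= l)%N -> (l <= beta)%N ->
    (forall k : nat, (k < l)%N ->
       mg_well_defined (multigrid fA0 fB0 fC0 pA pC beta k)) ->
    (exists zB : nat,
       trig_degree (sym_B (multigrid fA0 fB0 fC0 pA pC beta l)) zB /\
       (zB <= maxn (2 * zB0) (4 * q))%N) /\
    (exists zC : nat,
       trig_degree (sym_C (multigrid fA0 fB0 fC0 pA pC beta l)) zC /\
       (zC <= maxn (4 * zB0) (maxn (6 * q) (2 * zC0)))%N).
Proof.
move=> q; have [zA0 hzA0] := hA0.
have pAq : trig_le q pA := trig_leW (leq_maxl _ _) (trig_degree_le hpA).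
have pCq : trig_le q pC := trig_leW (leq_maxr _ _) (trig_degree_le hpC).
(* The thresholds come from numerical sequences determined by [q] and the initial bounds, hence are
   fixed before [beta]. *)
have [lB hlB] := bound_B_eventually q zA0 zB0.
have [lC hlC] := bound_C_eventually q zA0 zB0 zC0.
exists (maxn lB lC) => beta l; rewrite geq_max => /andP[lBl lCl] _ _.
have [_ hB hC] := multigrid_trig_le hzA0 (trig_degree_le hB0)
  (trig_degree_le hC0) pAq pCq beta l.
have [zB [degB leB]] := trig_le_degree hB.
have [zC [degC leC]] := trig_le_degree hC.
by split; [exists zB | exists zC]; split=> //;
  [have := hlB l lBl | have := hlC l lCl]; lia.
Qed.
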